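(* Fix integers $m \geq 1$ and $n \geq 0$, and let $\mathsf{G3Ldm}_{n}^{m}$ be the labelled sequent calculus described in the context. Then: (1) every sequent of the form $\mathcal{R}, w:\phi, w:\overline{\phi}, \Gamma$ (with $\phi \in \mathcal{L}^m$ arbitrary) is derivable in $\mathsf{G3Ldm}_{n}^{m}$; (2) substitution of labels is height-preserving admissible: if $\Lambda$ is derivable with height at most $h$, then the sequent $\Lambda(y/x)$ obtained by replacing every occurrence of the label $x$ by the label $y$ is derivable with height at most $h$; (3) every inference rule of $\mathsf{G3Ldm}_{n}^{m}$ is height-preserving invertible: if the conclusion of an instance of a rule is derivable with height at most $h$, then each premise of that instance is derivable with height at most $h$; (4) the following weakening and contraction rules are height-preserving admissible: $$\frac{\mathcal{R},\Gamma}{\mathcal{R},\mathcal{R}',\Gamma',\Gamma}\,(\mathsf{wk}) \qquad \frac{\mathcal{R},\mathcal{R}',\mathcal{R}',\Gamma}{\mathcal{R},\mathcal{R}',\Gamma}\,(\mathsf{ctr})_{\mathsf{R}} \qquad \frac{\mathcal{R},\Gamma',\Gamma',\Gamma}{\mathcal{R},\Gamma',\Gamma}\,(\mathsf{ctr})_{\mathsf{F}}$$ (i.e., whenever the premise is derivable with height at most $h$, so is the conclusion); (5) the cut rule $$\frac{\mathcal{R},x:\phi,\Gamma \qquad \mathcal{R},x:\overline{\phi},\Gamma}{\mathcal{R},\Gamma}\,(\mathsf{cut})$$ is admissible (whenever both premises are derivable, so is the conclusion); (6) for every formula $\phi \in \mathcal{L}^m$ and label $w$, the sequent $w:\phi$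 is derivable in $\mathsf{G3Ldm}_{n}^{m}$ if and only if $\phi$ is a theorem of the Hilbert calculus $\mathsf{Ldm}_{n}^{m}$.
   Context: Language. Let $Ag=\{1,\dots,m\}$ be a set of agents and $Var$ a countable set of propositional variables. Formulas of $\mathcal{L}^m$ (negation normal form) are given by $\phi ::= p \mid \overline{p} \mid (\phi\wedge\phi) \mid (\phi\vee\phi) \mid \Box\phi \mid \Diamond\phi \mid [i]\phi \mid \langle i\rangle\phi$ with $p\in Var$, $i \in Ag$. The negation $\overline{\phi}$ of a formula is obtained by swapping $p$ and $\overline{p}$, $\wedge$ and $\vee$, $\Box$ and $\Diamond$, and $[i]$ and $\langle i\rangle$. Write $\phi\rightarrow\psi$ for $\overline{\phi}\vee\psi$, and $\phi \leftrightarrow\psi$ for $(\phi\to\psi)\wedge(\psi\to\phi)$. Hilbert calculus $\mathsf{Ldm}_{n}^{m}$. Axioms: all instances of $\phi \to (\psi\to\phi)$, $(\overline{\psi}\to\overline{\phi})\to(\phi\to\psi)$, $(\phi\to(\psi\to\chi))\to((\phi\to\psi)\to(\phi\to\chi))$; for $\Box$ and for each $[i]$ the S5 axioms $\Box(\phi\to\psi)\to(\Box\phi\to\Box\psi)$, $\Box\phi\to\phi$, $\Diamond\phi\to\Box\Diamond\phi$, $\Box\phi\vee\Diamond\overline{\phi}$ and $[i](\phi\to\psi)\to([i]\phi\to[i]\psi)$, $[i]\phi\to\phi$, $\langle i\rangle\phi\to[i]\langle i\rangle\phi$, $[i]\phi\vee\langle i\rangle\overline{\phi}$; (Bridge) $\Box\phi\to[i]\phi$;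 (IOA) $\bigwedge_{i\in Ag}\Diamond[i]\phi_i \to \Diamond(\bigwedge_{i\in Ag}[i]\phi_i)$; and, only when $n>0$, for each $i\in Ag$, $(\mathsf{APC}^i_n)$: $\Diamond[i]\phi_1 \wedge \Diamond(\overline{\phi}_1\wedge[i]\phi_2)\wedge\cdots\wedge\Diamond(\overline{\phi}_1\wedge\cdots\wedge\overline{\phi}_{n-1}\wedge[i]\phi_n)\to \phi_1\vee\cdots\vee\phi_n$. Rules: modus ponens and $\Box$-necessitation (from $\phi$ infer $\Box\phi$). A theorem is a formula derivable from no premises. Labelled sequents. Fix a denumerable set of labels $x,y,z,w,u,v,\dots$. A labelled sequent $\mathcal{R},\Gamma$ consists of a multiset $\mathcal{R}$ of relational atoms $\mathcal{R}_i xy$ ($i\in Ag$) and a multiset $\Gamma$ of labelled formulas $x:\phi$ ($\phi\in\mathcal{L}^m$). Derivations are finite trees of rule instances whose leaves are instances of $(\mathsf{id})$; height is the length of the longest branch. Rules of $\mathsf{G3Ldm}_{n}^{m}$ (written premise(s) / conclusion): $(\mathsf{id})$: no premise / $\mathcal{R}, w:p, w:\overline{p},\Gamma$. $(\wedge)$: $\mathcal{R}, w:\phi\wedge\psi, w:\phi,\Gamma$ and $\mathcal{R}, w:\phi\wedge\psi, w:\psi,\Gamma$ / $\mathcal{R}, w:\phi\wedge\psi,\Gamma$. $(\vee)$: $\mathcal{R}, w:\phi\vee\psi, w:\phi, w:\psi,\Gamma$ / $\mathcal{R}, w:\phi\vee\psi,\Gamma$. $([i])$: $\mathcal{R},\mathcal{R}_iwv,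 v:\phi,\Gamma$ / $\mathcal{R}, w:[i]\phi,\Gamma$, with $v$ not occurring in the conclusion. $(\Box)$: $\mathcal{R}, w:\Box\phi, v:\phi,\Gamma$ / $\mathcal{R}, w:\Box\phi,\Gamma$, with $v$ not occurring in the conclusion. $(\Diamond)$: $\mathcal{R}, w:\Diamond\phi, u:\phi,\Gamma$ / $\mathcal{R}, w:\Diamond\phi,\Gamma$ ($u$ any label). $(\mathsf{IOA})$: $\mathcal{R},\mathcal{R}_1u_1v,\dots,\mathcal{R}_mu_mv,\Gamma$ / $\mathcal{R},\Gamma$, with $v$ not occurring in the conclusion ($u_1,\dots,u_m$ any labels). $(\langle i\rangle)$: $\mathcal{R},\mathcal{R}_iwu, w:\langle i\rangle\phi, u:\phi,\Gamma$ / $\mathcal{R},\mathcal{R}_iwu, w:\langle i\rangle\phi,\Gamma$. $(\mathsf{refl}_i)$: $\mathcal{R},\mathcal{R}_iww,\Gamma$ / $\mathcal{R},\Gamma$. $(\mathsf{eucl}_i)$: $\mathcal{R},\mathcal{R}_iwu,\mathcal{R}_iwv,\mathcal{R}_iuv,\Gamma$ / $\mathcal{R},\mathcal{R}_iwu,\mathcal{R}_iwv,\Gamma$. $(\mathsf{APC}^i_n)$ (only when $n>0$): for any labels $w_0,\dots,w_n$, the premises $\mathcal{R},\mathcal{R}_iw_kw_j,\Gamma$ for all $0\le k\le n-1$, $k+1\le j\le n$ / $\mathcal{R},\Gamma$. There is a copy of $([i])$, $(\langle i\rangle)$, $(\mathsf{refl}_i)$, $(\mathsf{eucl}_i)$,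 $(\mathsf{APC}^i_n)$ for each $i\in Ag$. *)

(* Defs.v *)
From mathcomp Require Import all_boot.
From Stdlib Require List Permutation.

Set Implicit Arguments.
Unset Strict Implicit.
Unset Printing Implicit Defensive.

Inductive form (m : nat) : Type :=
| Var of nat
| NVar of nat
| And of form m & form m
| Or of form m & form m
| Box of form m
| Dia of form m
| Stit of 'I_m & form m
| CStit of 'I_m & form m.

Arguments Var {m}. Arguments NVar {m}. Arguments And {m}. Arguments Or {m}.
Arguments Box {m}. Arguments Dia {m}. Arguments Stit {m}. Arguments CStit {m}.

Fixpoint neg (m : nat) (f : form m) : form m :=
  match f with
  | Var p => NVar p
  | NVar p => Var p
  | And a b => Or (neg a) (neg b)
  | Or a b => And (neg a) (neg b)
  | Box a => Dia (neg a)
  | Dia a => Box (neg a)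
  | Stit i a => CStit i (neg a)
  | CStit i a => Stit i (neg a)
  end.

Definition imp (m : nat) (a b : form m) : form m := Or (neg a) b.
Definition iff (m : nat) (a b : form m) : form m := And (imp a b) (imp b a).

(* finite conjunction/disjunction  a1 /\ (a2 /\ ( ... /\ ak)); the empty
   cases (never used for m >= 1) default to p0 \/ ~p0 and p0 /\ ~p0. *)
Fixpoint bigAnd (m : nat) (l : seq (form m)) : form m :=
  match l with
  | [::] => Or (Var 0) (NVar 0)
  | [:: a] => a
  | a :: l' => And a (bigAnd l')
  end.

Fixpoint bigOr (m : nat) (l : seq (form m)) : form m :=
  match l with
  | [::] => And (Var 0) (NVar 0)
  | [:: a] => a
  | a :: l' => Or a (bigOr l')
  end.

Inductive thm (m n : nat) : form m -> Prop :=
| AxK1 (a b : form m) : thm n (imp a (imp b a))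
| AxCP (a b : form m) : thm n (imp (imp (neg b) (neg a)) (imp a b))
| AxS (a b c : form m) :
    thm n (imp (imp a (imp b c)) (imp (imp a b) (imp a c)))
| BoxK (a b : form m) : thm n (imp (Box (imp a b)) (imp (Box a) (Box b)))
| BoxT (a : form m) : thm n (imp (Box a) a)
| Box5 (a : form m) : thm n (imp (Dia a) (Box (Dia a)))
| BoxDual (a : form m) : thm n (Or (Box a) (Dia (neg a)))
| StitK (i : 'I_m) (a b : form m) :
    thm n (imp (Stit i (imp a b)) (imp (Stit i a) (Stit i b)))
| StitT (i : 'I_m) (a : form m) : thm n (imp (Stit i a) a)
| Stit5 (i : 'I_m) (a : form m) : thm n (imp (CStit i a) (Stit i (CStit i a)))
| StitDual (i : 'I_m) (a : form m) : thm n (Or (Stit i a) (CStit i (neg a)))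
| Bridge (i : 'I_m) (a : form m) : thm n (imp (Box a) (Stit i a))
| IOA (f : 'I_m -> form m) :
    thm n (imp (bigAnd [seq Dia (Stit i (f i)) | i <- enum 'I_m])
               (Dia (bigAnd [seq Stit i (f i) | i <- enum 'I_m])))
| APC (i : 'I_m) (f : nat -> form m) : 0 < n ->
    thm n (imp (bigAnd [seq Dia (bigAnd (rcons [seq neg (f j) | j <- iota 1 k.-1]
                                               (Stit i (f k))))
                       | k <- iota 1 n])
               (bigOr [seq f k | k <- iota 1 n]))
| MP (a b : form m) : thm n (imp a b) -> thm n a -> thm n b
| Nec (a : form m) : thm n a -> thm n (Box a).

Arguments thm {m} n _.

(* Labelled sequents. Multisets are lists considered up to permutation. *)

Definition label := nat.
(* relational atom R_i x y  is  (i, x, y) *)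
Definition ratom (m : nat) := ('I_m * label * label)%type.
Definition lform (m : nat) := (label * form m)%type.
Definition sequent (m : nat) := (seq (ratom m) * seq (lform m))%type.

Definition seq_equiv (m : nat) (S T : sequent m) : Prop :=
  Permutation.Permutation S.1 T.1 /\ Permutation.Permutation S.2 T.2.

Definition occurs (m : nat) (v : label) (S : sequent m) : Prop :=
  (exists a : ratom m, List.In a S.1 /\ (a.1.2 = v \/ a.2 = v)) \/
  (exists A : form m, List.In (v, A) S.2).

Inductive id_inst (m : nat) : sequent m -> Prop :=
| IdI (R : seq (ratom m)) (G : seq (lform m)) (w : label) (p : nat) :
    id_inst (R, (w, Var p) :: (w, NVar p) :: G).

Inductive rule_inst (m n : nat) : seq (sequent m) -> sequent m -> Prop :=
| RAnd R G w (a b : form m) :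
    rule_inst n [:: (R, (w, And a b) :: (w, a) :: G); (R, (w, And a b) :: (w, b) :: G)]
                (R, (w, And a b) :: G)
| ROr R G w (a b : form m) :
    rule_inst n [:: (R, (w, Or a b) :: (w, a) :: (w, b) :: G)] (R, (w, Or a b) :: G)
| RStit R G w v (i : 'I_m) (a : form m) :
    ~ occurs v (R, (w, Stit i a) :: G) ->
    rule_inst n [:: ((i, w, v) :: R, (v, a) :: G)] (R, (w, Stit i a) :: G)
| RBox R G w v (a : form m) :
    ~ occurs v (R, (w, Box a) :: G) ->
    rule_inst n [:: (R, (w, Box a) :: (v, a) :: G)] (R, (w, Box a) :: G)
| RDia R G w u (a : form m) :
    rule_inst n [:: (R, (w, Dia a) :: (u, a) :: G)] (R, (w, Dia a) :: G)
| RIOA R G (u : 'I_m -> label) v :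
    ~ occurs v (R, G) ->
    rule_inst n [:: ([seq (i, u i, v) | i <- enum 'I_m] ++ R, G)] (R, G)
| RCStit R G w u (i : 'I_m) (a : form m) :
    rule_inst n [:: ((i, w, u) :: R, (w, CStit i a) :: (u, a) :: G)]
                ((i, w, u) :: R, (w, CStit i a) :: G)
| RRefl R G w (i : 'I_m) :
    rule_inst n [:: ((i, w, w) :: R, G)] (R, G)
| REucl R G w u v (i : 'I_m) :
    rule_inst n [:: ((i, w, u) :: (i, w, v) :: (i, u, v) :: R, G)]
                ((i, w, u) :: (i, w, v) :: R, G)
| RAPC R G (i : 'I_m) (ws : nat -> label) : 0 < n ->
    rule_inst n [seq ((i, ws k, ws j) :: R, G) | k <- iota 0 n, j <- iota k.+1 (n - k)]
                (R, G).

Arguments rule_inst {m} n _ _.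

Inductive derh (m n : nat) : nat -> sequent m -> Prop :=
| DId h (S S' : sequent m) : id_inst S -> seq_equiv S S' -> derh n h S'
| DRule h (prems : seq (sequent m)) (S S' : sequent m) :
    rule_inst n prems S -> seq_equiv S S' ->
    (forall P, List.In P prems -> derh n h P) -> derh n h.+1 S'.

Arguments derh {m} n _ _.

Definition derivable (m n : nat) (S : sequent m) : Prop := exists h, derh n h S.
Arguments derivable {m} n _.

Definition lsub (x y z : label) : label := if z == x then y else z.

Definition subst_seq (m : nat) (x y : label) (S : sequent m) : sequent m :=
  ([seq (a.1.1, lsub x y a.1.2, lsub x y a.2) | a <- S.1],
   [seq (lsub x y A.1, A.2) | A <- S.2]).

(* Main.v *)
(** Every rule but [Stit] keeps its principal formula, so one induction on height
    proves a single statement from which substitution, inversion, weakening and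
    contraction all follow: if a sequent [S] is derivable and [T] contains, up to
    a map of labels, every relational atom of [S], and every formula of [S] either
    occurs in [T] or has been decomposed in [T], then [T] is derivable with the
    same height.  The same induction with another notion of containment, where a
    missing cut formula is excused by a derivation from its negation, moves a cut
    up to the principal occurrences of the cut formula and reduces it to
    cuts on subformulas.

    Hilbert axioms are derived directly, modus ponens being a cut.  Conversely,
    derivable sequents are valid in the canonical model, whose points are maximal
    consistent sets: (IOA) provides the independence of agents there and (APC)
    the bound on the number of choices.  Hence a derivable formula lies in every
    maximal consistent set and is a theorem. *)
Require Import Defs.
From mathcomp Require Import all_boot.
From Stdlib Require List Permutation.
From Stdlib Require Import Classical.

Set Implicit Arguments.
Unset Strict Implicit.
Unset Printing Implicit Defensive.

Import Permutation.

(** * Negation and membership in lists *)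

Lemma negK (m : nat) : involutive (@neg m).
Proof. by elim=> //= [a -> b ->|a -> b ->|a ->|a ->|i a ->|i a ->]. Qed.

Lemma In_perm (A : Type) (x : A) l :
  List.In x l -> exists l', Permutation (x :: l') l.
Proof.
by move=> /(@List.in_split _ _) [l1 [l2 ->]]; exists (l1 ++ l2); exact: Permutation_middle.
Qed.

Lemma In_memP (T : eqType) (x : T) s : List.In x s <-> x \in s.
Proof.
elim: s => //= y s IH; rewrite inE IH.
by split=> [[->|->]|/orP [/eqP->|]]; rewrite ?eqxx ?orbT; auto.
Qed.

Lemma In_mapP (A B : Type) (f : A -> B) s y :
  List.In y [seq f x | x <- s] <-> exists2 x, y = f x & List.In x s.
Proof.
elim: s => [|x s IH] /=; first by split=> [|[]].
rewrite IH; split=> [[<-|[z -> ?]]|[z -> [->|?]]]; [exists x| exists z| |right; exists z]; auto.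
Qed.

Lemma In_catP (A : Type) (s t : seq A) x :
  List.In x (s ++ t) <-> List.In x s \/ List.In x t.
Proof. exact: List.in_app_iff. Qed.

Section Calculus.
Context (m n : nat).
Implicit Types (S T : sequent m) (R : seq (ratom m)) (G : seq (lform m)).

Lemma equiv_trans S T U : seq_equiv S T -> seq_equiv T U -> seq_equiv S U.
Proof.
by case=> a b [c d]; split; [exact: Permutation_trans a c | exact: Permutation_trans b d].
Qed.

Lemma exists_fresh S : exists v, ~ occurs v S.
Proof.
suff [N HN] : exists N, forall v, occurs v S -> v < N.
  by exists N => /HN; rewrite ltnn.
case: S => R G.
have [N1 H1] : exists N, forall a : ratom m, List.In a R -> a.1.2 < N /\ a.2 < N.
  elim: R => [|[[i x] y] R [N HN]]; first by exists 0.
  exists (maxn N (maxn x y).+1) => a [<-|/HN [? ?]] /=; rewrite !leq_max !ltnS ?leq_max.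
    by rewrite !leqnn !orbT.
  by split; apply/orP; left.
have [N2 H2] : exists N, forall v (A : form m), List.In (v, A) G -> v < N.
  elim: G => [|[x A] G [N HN]]; first by exists 0.
  exists (maxn N x.+1) => v B [[<- _]|/HN ?] /=; rewrite leq_max ?leqnn ?orbT //.
  by apply/orP; left.
exists (maxn N1 N2) => v; rewrite leq_max => -[[a [/H1 [? ?] [<-|<-]]]|[A /H2 ?]];
  by apply/orP; auto.
Qed.

Lemma In_apc_premises (i : 'I_m) (ws : nat -> label) R G P :
  List.In P [seq ((i, ws k, ws j) :: R, G) | k <- iota 0 n, j <- iota k.+1 (n - k)]
  <-> exists k j, k < j <= n /\ P = ((i, ws k, ws j) :: R, G).
Proof.
have E k j : (k < n) /\ (k < j < k.+1 + (n - k)) <-> k < j <= n.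
  split=> [[kn /andP [kj]]|/andP [kj jn]].
    by rewrite addSn ltnS subnKC ?(ltnW kn) // => ->; rewrite kj.
  have kn := leq_trans kj jn; split=> //.
  by rewrite kj addSn ltnS subnKC // ltnW.
suff H s : List.In P [seq ((i, ws k, ws j) :: R, G) | k <- s, j <- iota k.+1 (n - k)]
   <-> exists k j, [/\ k \in s, j \in iota k.+1 (n - k) & P = ((i, ws k, ws j) :: R, G)].
  split=> [/H|] [k [j]].
    by rewrite !mem_iota add0n => -[? ? ->]; exists k, j; split=> //; apply/E.
  by case=> /E [? ?] EP; apply/H; exists k, j; rewrite !mem_iota add0n.
elim: s => [|k s IH]; first by split=> // -[k [j []]].
rewrite /= In_catP In_mapP IH; split=> [[[j ->]|[k' [j [? ? ->]]]]|[k' [j []]]].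
- by rewrite In_memP => ?; exists k, j; rewrite inE eqxx.
- by exists k', j; rewrite inE; split=> //; apply/orP; right.
- rewrite inE => /orP [/eqP ->|?] ? ->; last by right; exists k', j.
  by left; exists j => //; apply/In_memP.
Qed.

(** * Rules up to permutation of sequents *)

(** Two predicates allow one set of rule lemmas to serve both [derh n h] with [derh n h.+1], where a
    rule costs one unit of height, and [derivable n] with itself. *)
Record rule_closed (D D' : sequent m -> Prop) : Prop := RuleClosed {
  rc_equiv : forall S S', seq_equiv S S' -> D S -> D S';
  rc_rule : forall prems S S', rule_inst n prems S -> seq_equiv S S' ->
    (forall P, List.In P prems -> D P) -> D' S' }.

Section SetRules.
Context (D D' : sequent m -> Prop) (rc : rule_closed D D').

Lemma rc_and R G w a b : List.In (w, And a b) G ->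
  D (R, (w, a) :: G) -> D (R, (w, b) :: G) -> D' (R, G).
Proof.
move=> /(@In_perm (lform m)) [G' E] Da Db.
apply: (rc_rule rc (RAnd n R G' w a b)) => [//|P [<-|[<-|[]]]];
  [apply: (rc_equiv rc) Da | apply: (rc_equiv rc) Db]; split=> //=;
  by rewrite -E; exact: perm_swap.
Qed.

Lemma rc_or R G w a b : List.In (w, Or a b) G ->
  D (R, (w, a) :: (w, b) :: G) -> D' (R, G).
Proof.
move=> /(@In_perm (lform m)) [G' E] Da.
apply: (rc_rule rc (ROr n R G' w a b)) => [//|P [<-|[]]].
apply: (rc_equiv rc) Da; split=> //=.
rewrite -E; exact: Permutation_sym (Permutation_middle [:: (w, a); (w, b)] G' (w, Or a b)).
Qed.

(** This rule deletes its principal formula, hence a permutation that isolates the formula in place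
    of a membership hypothesis. *)
Lemma rc_stit R G' G w i a : Permutation ((w, Stit i a) :: G') G ->
  (forall v, D ((i, w, v) :: R, (v, a) :: G')) -> D' (R, G).
Proof.
move=> E Da; have [v Hv] := exists_fresh (R, (w, Stit i a) :: G').
by apply: (rc_rule rc (RStit n Hv)) => [//|P [<-|[]]].
Qed.

Lemma rc_box R G w a : List.In (w, Box a) G ->
  (forall v, D (R, (v, a) :: G)) -> D' (R, G).
Proof.
move=> /(@In_perm (lform m)) [G' E] Da; have [v Hv] := exists_fresh (R, (w, Box a) :: G').
apply: (rc_rule rc (RBox n Hv)) => [//|P [<-|[]]].
apply: (rc_equiv rc) (Da v); split=> //=.
by rewrite -E; exact: perm_swap.
Qed.

Lemma rc_dia R G w u a : List.In (w, Dia a) G ->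
  D (R, (u, a) :: G) -> D' (R, G).
Proof.
move=> /(@In_perm (lform m)) [G' E] Da.
apply: (rc_rule rc (RDia n R G' w u a)) => [//|P [<-|[]]].
apply: (rc_equiv rc) Da; split=> //=.
by rewrite -E; exact: perm_swap.
Qed.

Lemma rc_cstit R G w u i a : List.In (i, w, u) R -> List.In (w, CStit i a) G ->
  D (R, (u, a) :: G) -> D' (R, G).
Proof.
move=> /(@In_perm (ratom m)) [R' E'] /(@In_perm (lform m)) [G' E] Da.
apply: (rc_rule rc (RCStit n R' G' w u i a)) => [//|P [<-|[]]].
apply: (rc_equiv rc) Da; split=> /=; first exact: Permutation_sym.
by rewrite -E; exact: perm_swap.
Qed.

(* The labels [u i] may depend on the eigenvariable because the rule allows
   some [u i] to be equal to it. *)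
Lemma rc_ioa R G :
  (forall v, exists u : 'I_m -> label,
     D ([seq (i, u i, v) | i <- enum 'I_m] ++ R, G)) -> D' (R, G).
Proof.
move=> H; have [v Hv] := exists_fresh (R, G); have [u Du] := H v.
by apply: (rc_rule rc (RIOA n u Hv)) => [//|P [<-|[]]].
Qed.

Lemma rc_refl R G i w : D ((i, w, w) :: R, G) -> D' (R, G).
Proof. by move=> Da; apply: (rc_rule rc (RRefl n R G w i)) => [//|P [<-|[]]]. Qed.

Lemma rc_eucl R G i w u v : List.In (i, w, u) R -> List.In (i, w, v) R ->
  D ((i, u, v) :: R, G) -> D' (R, G).
Proof.
(* For [u = v], membership guarantees only one copy of the atom while the rule consumes two; the
   atom to be added is then a reflexive one. *)
have [->|uv] := eqVneq u v; first by move=> _ _; exact: rc_refl.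
move=> /(@In_perm (ratom m)) [R' E'] Hv Da.
have : List.In (i, w, v) ((i, w, u) :: R') by exact: Permutation_in (Permutation_sym E') Hv.
case=> [[E]|/(@In_perm (ratom m)) [R2 E]]; first by rewrite E eqxx in uv.
have E2 : Permutation ((i, w, u) :: (i, w, v) :: R2) R.
  by rewrite -E'; exact: perm_skip.
apply: (rc_rule rc (REucl n R2 G w u v i)) => [//|P [<-|[]]].
apply: (rc_equiv rc) Da; split=> //=.
rewrite -E2; exact: (Permutation_middle [:: (i, w, u); (i, w, v)] R2 (i, u, v)).
Qed.

Lemma rc_apc R G i (ws : nat -> label) : 0 < n ->
  (forall k j, k < j <= n -> D ((i, ws k, ws j) :: R, G)) -> D' (R, G).
Proof.
move=> n0 H; apply: (rc_rule rc (RAPC R G i ws n0)) => [//|P].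
by rewrite In_apc_premises => -[k [j [? ->]]]; exact: H.
Qed.

End SetRules.

Lemma derh_equiv h S T : seq_equiv S T -> derh n h S -> derh n h T.
Proof.
move=> E H; case: H E => {h S} [h S S' HS E'|h ps S S' HS E' Hp] E.
  exact: DId HS (equiv_trans E' E).
exact: DRule HS (equiv_trans E' E) Hp.
Qed.

Lemma derhS h S : derh n h S -> derh n h.+1 S.
Proof.
elim=> {h S} [h S S' HS E|h ps S S' HS E _ IH]; first exact: DId HS E.
exact: DRule HS E IH.
Qed.

Lemma derh_le h h' S : h <= h' -> derh n h S -> derh n h' S.
Proof.
move=> /subnKC <-; elim: (h' - h) => [|k IH]; rewrite ?addn0 // addnS.
by move=> /IH /derhS.
Qed.

Lemma derh_rule_closed h : rule_closed (derh n h) (derh n h.+1).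
Proof. by split=> *; [apply: derh_equiv; eauto | apply: DRule; eauto]. Qed.

Lemma derivable_rule_closed : rule_closed (derivable n) (derivable n).
Proof.
split=> [S S' E [h /(derh_equiv E)]|ps S S' HS E Hp]; first by exists h.
(* Finitely many premises have a common height, the maximum of their own. *)
have [h Hh] : exists h, forall P, List.In P ps -> derh n h P.
  elim: ps Hp {HS} => [|P ps IH] Hp; first by exists 0.
  have [|h Hh] := IH; first by move=> Q HQ; apply: Hp; right.
  have [|h' Hh'] := Hp P; first by left.
  exists (maxn h h') => Q [<-|/Hh]; last by apply: derh_le; exact: leq_maxl.
  by apply: derh_le Hh'; exact: leq_maxr.
by exists h.+1; apply: DRule HS E Hh.
Qed.

(** * Transfer of derivations along a map of labels *)

Definition update (Y : Type) (s : label -> Y) v y z := if z == v then y else s z.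

Lemma update_eq (Y : Type) (s : label -> Y) v y : update s v y v = y.
Proof. by rewrite /update eqxx. Qed.

Lemma update_fresh (Y : Type) (s : label -> Y) v y S w (A : form m) :
  ~ occurs v S -> List.In (w, A) S.2 -> update s v y w = s w.
Proof.
by rewrite /update; case: eqP => // -> Hv H; case: Hv; right; exists A.
Qed.

Lemma update_fresh_rel (Y : Type) (s : label -> Y) v y S i x z :
  ~ occurs v S -> List.In (i, x, z) S.1 ->
  update s v y x = s x /\ update s v y z = s z.
Proof.
by rewrite /update => Hv H; split; case: eqP => // E; case: Hv; left; exists (i, x, z);
  split=> //; [left | right].
Qed.

Section Interpretation.
(* [C T w A] says that the label-formula pair [(w, A)] is accounted for in [T];
   it abstracts from membership. *)
Context (D : nat -> sequent m -> Prop) (C : sequent m -> label -> form m -> Prop).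

(** Formulas are compared through [C] instead of membership, because a sequent may lose the
    principal formula of [Stit] and still account for it. The hypotheses [D_and] to [D_cstit]
    quantify over all extensions of [T], so a rule can either be applied or be skipped when its
    effect is already present. *)
Definition extends T T' :=
  (forall a, List.In a T.1 -> List.In a T'.1) /\
  (forall w A, C T w A -> C T' w A).

Definition embeds (s : label -> label) S T :=
  (forall i x y, List.In (i, x, y) S.1 -> List.In (i, s x, s y) T.1) /\
  (forall w A, List.In (w, A) S.2 -> C T (s w) A).

Context (Drc : forall h, rule_closed (D h) (D h.+1)).
Context (C_rel : forall R R' G w A, (forall a, List.In a R -> List.In a R') ->
  C (R, G) w A -> C (R', G) w A).
Context (D_id : forall h T w p, C T w (Var p) -> C T w (NVar p) -> D h T).
Context (D_and : forall h T w a b, C T w (And a b) ->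
  (forall T', extends T T' -> C T' w a -> D h T') ->
  (forall T', extends T T' -> C T' w b -> D h T') -> D h.+1 T).
Context (D_or : forall h T w a b, C T w (Or a b) ->
  (forall T', extends T T' -> C T' w a -> C T' w b -> D h T') -> D h.+1 T).
Context (D_box : forall h T w a, C T w (Box a) ->
  (forall T' v, extends T T' -> C T' v a -> D h T') -> D h.+1 T).
Context (D_dia : forall h T w u a, C T w (Dia a) ->
  (forall T', extends T T' -> C T' u a -> D h T') -> D h.+1 T).
Context (D_stit : forall h T w i a, C T w (Stit i a) ->
  (forall T' v, extends T T' -> List.In (i, w, v) T'.1 -> C T' v a -> D h T') ->
  D h.+1 T).
Context (D_cstit : forall h T w u i a, C T w (CStit i a) -> List.In (i, w, u) T.1 ->
  (forall T', extends T T' -> C T' u a -> D h T') -> D h.+1 T).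

Lemma embeds_extends s S T T' : extends T T' -> embeds s S T -> embeds s S T'.
Proof. by move=> [e1 e2] [f1 f2]; split=> *; [apply: e1; apply: f1|apply: e2; apply: f2]. Qed.

Lemma embeds_cons s R G T w A :
  C T (s w) A -> embeds s (R, G) T -> embeds s (R, (w, A) :: G) T.
Proof. by move=> HA [e1 e2]; split=> //= w' A' [[<- <-]|/e2]. Qed.

Lemma embeds_cons_rel s R G T i x y :
  List.In (i, s x, s y) T.1 -> embeds s (R, G) T -> embeds s ((i, x, y) :: R, G) T.
Proof. by move=> HA [e1 e2]; split=> //= i' x' y' [[<- <- <-]|/e1]. Qed.

Lemma embeds_tail s R G T w A : embeds s (R, (w, A) :: G) T -> embeds s (R, G) T.
Proof. by move=> [e1 e2]; split=> //= w' A' H; apply: e2; right. Qed.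

Lemma embeds_update s S T v y : ~ occurs v S -> embeds s S T -> embeds (update s v y) S T.
Proof.
move=> Hv [e1 e2]; split=> [i x z H|w A H].
  by case: (update_fresh_rel s y Hv H) => -> ->; exact: e1.
by rewrite (update_fresh s y Hv H); exact: e2.
Qed.

Lemma embeds_equiv s S S' T : seq_equiv S S' -> embeds s S' T -> embeds s S T.
Proof.
by move=> [p1 p2] [e1 e2]; split=> *; [apply: e1; apply: Permutation_in p1 _
  | apply: e2; apply: Permutation_in p2 _].
Qed.

Lemma extends_rel R R' G : (forall a, List.In a R -> List.In a R') ->
  extends (R, G) (R', G).
Proof. by move=> H; split=> // w A; apply: C_rel. Qed.

(** The map [s] and the target [T] vary in the induction: [s] is reassigned at eigenvariables, and
    [T] is extended along the branch. Relational rules are replayed on [T] with labels renamed by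
    [s]; logical rules are delegated to the hypotheses on [D] and [C]. *)
Theorem interpretation h S : derh n h S -> forall s T, embeds s S T -> D h T.
Proof.
elim=> {h S} [h S S' [R G w p] E s T /(embeds_equiv E) [_ e2]|h ps S S' HS E _ IH s T].
  by apply: (@D_id h T (s w) p); apply: e2; [left | right; left].
move=> /(embeds_equiv E) {S' E}.
case: HS IH => {ps S}.
- move=> R G w a b IH e; have [_ e2] := e.
  apply: (D_and (e2 _ _ (or_introl erefl))) => T' x cA.
    apply: (IH _ (or_introl erefl) s T').
    have e' := embeds_extends x e; apply: embeds_cons (embeds_cons cA (embeds_tail e')).
    by case: e' => _; apply; left.
  apply: (IH _ (or_intror (or_introl erefl)) s T').
  have e' := embeds_extends x e; apply: embeds_cons (embeds_cons cA (embeds_tail e')).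
  by case: e' => _; apply; left.
- move=> R G w a b IH e; have [_ e2] := e.
  apply: (D_or (e2 _ _ (or_introl erefl))) => T' x cA cB.
  apply: (IH _ (or_introl erefl) s T').
  have e' := embeds_extends x e.
  apply: embeds_cons (embeds_cons cA (embeds_cons cB (embeds_tail e'))).
  by case: e' => _; apply; left.
- move=> R G w v i a Hv IH e; have [_ e2] := e.
  have wv : w != v.
    by apply/eqP => E; apply: Hv; right; exists (Stit i a); left; rewrite E.
  apply: (D_stit (e2 _ _ (or_introl erefl))) => T' y x cR cA.
  apply: (IH _ (or_introl erefl) (update s v y) T').
  have e' := embeds_update y Hv (embeds_extends x e).
  apply: embeds_cons_rel; first by rewrite /update eqxx (negbTE wv).
  by apply: embeds_cons (embeds_tail e'); rewrite /update eqxx.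
- move=> R G w v a Hv IH e; have [_ e2] := e.
  apply: (D_box (e2 _ _ (or_introl erefl))) => T' y x cA.
  apply: (IH _ (or_introl erefl) (update s v y) T').
  have e' := embeds_update y Hv (embeds_extends x e).
  have cA' : C T' (update s v y v) a by rewrite /update eqxx.
  apply: embeds_cons (embeds_cons cA' (embeds_tail e')).
  by case: e' => _; apply; left.
- move=> R G w u a IH e; have [_ e2] := e.
  apply: (D_dia (u := s u) (e2 _ _ (or_introl erefl))) => T' x cA.
  apply: (IH _ (or_introl erefl) s T').
  have e' := embeds_extends x e; apply: embeds_cons (embeds_cons cA (embeds_tail e')).
  by case: e' => _; apply; left.
- move=> R G u v Hv IH e; case: T e => RT GT e.
  apply: (rc_ioa (Drc h)) => y; exists (fun i => update s v y (u i)).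
  apply: (IH _ (or_introl erefl) (update s v y)).
  have [|e1' e2'] := embeds_extends
      (T' := ([seq (i, update s v y (u i), y) | i <- enum 'I_m] ++ RT, GT))
      _ (embeds_update y Hv e).
    by apply: extends_rel => a H; apply/(@In_catP (ratom m)); right.
  split=> // i x z /(@In_catP (ratom m)) [|]; last exact: e1'.
  move=> /(@In_mapP _ (ratom m)) [j [-> -> ->] Hj].
  apply/(@In_catP (ratom m)); left; apply/(@In_mapP _ (ratom m)).
  by exists j; rewrite // update_eq.
- move=> R G w u i a IH e; have [e1 e2] := e.
  apply: (D_cstit (u := s u) (e2 _ _ (or_introl erefl)) (e1 _ _ _ (or_introl erefl))) => T' x cA.
  apply: (IH _ (or_introl erefl) s T').
  have e' := embeds_extends x e; apply: embeds_cons (embeds_cons cA (embeds_tail e')).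
  by case: e' => _; apply; left.
- move=> R G w i IH; case: T => RT GT e.
  apply: (rc_refl (Drc h) (i := i) (w := s w)); apply: (IH _ (or_introl erefl) s _).
  by apply: embeds_cons_rel; [left | apply: embeds_extends e; apply: extends_rel; right].
- move=> R G w u v i IH; case: T => RT GT e; have [e1 _] := e.
  apply: (rc_eucl (Drc h) (e1 _ _ _ (or_introl erefl)) (e1 _ _ _ (or_intror (or_introl erefl)))).
  apply: (IH _ (or_introl erefl) s _).
  have [|e1' e2'] := @embeds_extends s _ _ ((i, s u, s v) :: RT, GT) _ e.
    by apply: extends_rel; right.
  split=> // j x y [?|[?|[[<- <- <-]|?]]]; [ | |by left| ]; apply: e1'.
  + by left.
  + by right; left.
  + by right; right.
- move=> R G i ws n0 IH; case: T => RT GT e.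
  apply: (rc_apc (Drc h) (i := i) (ws := s \o ws) n0) => k j kj.
  apply: (IH ((i, ws k, ws j) :: R, G) _ s).
    by apply/In_apc_premises; exists k, j.
  by apply: embeds_cons_rel; [left | apply: embeds_extends e; apply: extends_rel; right].
Qed.

End Interpretation.

(** * Height-preserving properties *)

(* The second disjunct lists the ways in which a formula may have been replaced
   by premise formulas. *)
Fixpoint covered T (w : label) (A : form m) : Prop :=
  List.In (w, A) T.2 \/
  match A with
  | And a b => covered T w a \/ covered T w b
  | Or a b => covered T w a /\ covered T w b
  | Box a => exists v, covered T v a
  | Stit i a => exists2 v, List.In (i, w, v) T.1 & covered T v a
  | _ => False
  end.

Lemma covered_In T w A : List.In (w, A) T.2 -> covered T w A.
Proof. by case: A => *; left. Qed.

Lemma covered_mono T T' : (forall a, List.In a T.1 -> List.In a T'.1) ->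
  (forall w A, List.In (w, A) T.2 -> covered T' w A) ->
  forall w A, covered T w A -> covered T' w A.
Proof.
move=> H1 H2 w A; elim: A w => [p|p|a IHa b IHb|a IHa b IHb|a IHa|a IHa|i a IHa|i a IHa] w;
  case=> [/H2 //|] //=.
- by case=> [/IHa|/IHb] ?; right; [left | right].
- by case=> /IHa ? /IHb ?; right.
- by case=> v /IHa ?; right; exists v.
- by case=> v /H1 ? /IHa ?; right; exists v.
Qed.

Lemma covered_extends T T' : (forall a, List.In a T.1 -> List.In a T'.1) ->
  (forall w A, List.In (w, A) T.2 -> covered T' w A) -> extends covered T T'.
Proof. by move=> H1 H2; split=> // w A; apply: covered_mono. Qed.

Lemma covered_extends_incl R R' G G' : (forall a, List.In a R -> List.In a R') ->
  (forall A, List.In A G -> List.In A G') -> extends covered (R, G) (R', G').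
Proof.
by move=> H1 H2; apply: covered_extends => // w A H; apply: covered_In; exact: H2.
Qed.

(** A logical rule is replayed when its principal formula occurs in [T], and skipped when that
    formula is already decomposed there; [derhS] then absorbs the saved unit of height. *)
Theorem derh_covered h S s T : derh n h S -> embeds covered s S T -> derh n h T.
Proof.
have rc := derh_rule_closed.
have cons h0 R G w a : (forall T', extends covered (R, G) T' -> covered T' w a -> derh n h0 T') ->
    derh n h0 (R, (w, a) :: G).
  by apply; [apply: covered_extends_incl => // ? ?; right | apply: covered_In; left].
move=> d; apply: interpretation d s T => {h S} //.
- by move=> R R' G w A HR; apply: covered_mono => // ? ? ?; exact: covered_In.
- move=> h [R G] w p [H1|//] [H2|//]; case: (In_perm H1) => {H1} G1 /= E1.
  have : List.In (w, NVar p) ((w, Var p) :: G1) by exact: Permutation_in (Permutation_sym E1) H2.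
  case=> [//|/(@In_perm (lform m)) [G2 E2]].
  apply: (DId n h (IdI R G2 w p)); split=> //=.
  by rewrite -E1; exact: perm_skip.
- move=> h [R G] w a b [H|[c|c]] Ha Hb; last by apply/derhS/Hb.
    by apply: (rc_and (rc h) H); exact: cons.
  by apply/derhS/Ha.
- move=> h [R G] w a b [H|[ca cb]] Ha; last by apply/derhS/Ha.
  apply: (rc_or (rc h) H); apply: Ha.
  + by apply: covered_extends_incl => // ? ?; right; right.
  + by apply: covered_In; left.
  + by apply: covered_In; right; left.
- move=> h [R G] w a [H|[v c]] Ha; last by apply/derhS/Ha/c.
  by apply: (rc_box (rc h) H) => v; apply: cons => T' e c; exact: Ha e c.
- move=> h [R G] w u a [H|[]] Ha.
  by apply: (rc_dia (rc h) H); exact: cons Ha.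
- move=> h [R G] w i a [H|[v H c]] Ha; last by apply/derhS/Ha/c/H.
  case: (In_perm H) => G' E; apply: (rc_stit (rc h) E) => v.
  have cv : covered ((i, w, v) :: R, (v, a) :: G') v a by apply: covered_In; left.
  apply: (Ha _ v _ _ cv) => //=; last by left.
  (* The new sequent no longer contains [Stit i a] at [w], but covers it through the new atom and
     [a] at [v]. *)
  apply: covered_extends => [? ?|w' A]; first by right.
  move=> /(Permutation_in _ (Permutation_sym E)) [[<- <-]|H']; last by apply: covered_In; right.
  by right; exists v; rewrite /=; auto.
- move=> h [R G] w u i a [H|[]] HR Ha.
  by apply: (rc_cstit (rc h) HR H); exact: cons Ha.
Qed.

(** Inclusion ignores multiplicities, so weakening and both contractions are instances. *)
Lemma derh_incl h R R' G G' : (forall a, List.In a R -> List.In a R') ->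
  (forall A, List.In A G -> List.In A G') -> derh n h (R, G) -> derh n h (R', G').
Proof.
move=> H1 H2 d; apply: (derh_covered (s := id) d); split=> /= [i x y|w A]; first exact: H1.
by move=> H; apply: covered_In; exact: H2.
Qed.

Lemma derh_subst h S x y : derh n h S -> derh n h (subst_seq x y S).
Proof.
move=> d; apply: (derh_covered (s := lsub x y) d); split=> /= [i u v H|w A H].
  by apply/In_mapP; exists (i, u, v).
by apply: covered_In; apply/In_mapP; exists (w, A).
Qed.

Lemma derh_invert h ps S : rule_inst n ps S -> derh n h S ->
  forall P, List.In P ps -> derh n h P.
Proof.
case=> {ps S} [R G w a b|R G w a b|R G w v i a _|R G w v a _|R G w u a|R G u v _
  |R G w u i a|R G w i|R G w u v i|R G i ws _] d P.
- by case=> [<-|[<-|[]]]; apply: derh_incl d => //= A; intuition.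
- by case=> [<-|[]]; apply: derh_incl d => //= A; intuition.
(* The only premise that does not include its conclusion; the missing formula is covered through
   [v]. *)
- case=> [<-|[]]; apply: (derh_covered (s := id) d); split=> /= [j x y|x A]; first by right.
  case=> [[<- <-]|H]; last by apply: covered_In; right.
  by right; exists v; [left | apply: covered_In; left].
- by case=> [<-|[]]; apply: derh_incl d => //= A; intuition.
- by case=> [<-|[]]; apply: derh_incl d => //= A; intuition.
- case=> [<-|[]]; apply: derh_incl d => //= A HA.
  by apply/(@In_catP (ratom m)); right.
- by case=> [<-|[]]; apply: derh_incl d => //= A; intuition.
- by case=> [<-|[]]; apply: derh_incl d => //= A; intuition.
- by case=> [<-|[]]; apply: derh_incl d => //= A; intuition.
- by move/In_apc_premises => [k [j [_ ->]]]; apply: derh_incl d => //= A; intuition.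
Qed.

Lemma derivable_incl R R' G G' : (forall a, List.In a R -> List.In a R') ->
  (forall A, List.In A G -> List.In A G') -> derivable n (R, G) -> derivable n (R', G').
Proof. by move=> H1 H2 [h d]; exists h; exact: derh_incl d. Qed.

Let rc := derivable_rule_closed.

Lemma derivable_stit R G w i a : List.In (w, Stit i a) G ->
  (forall v, derivable n ((i, w, v) :: R, (v, a) :: G)) -> derivable n (R, G).
Proof.
case/(@In_perm (lform m)) => G' E H; apply: (rc_stit rc E) => v; have [h d] := H v.
exists h; apply: (derh_covered (s := id) d); split=> //= x A.
case=> [[<- <-]|/(Permutation_in _ (Permutation_sym E)) [[<- <-]|H']].
- by apply: covered_In; left.
- by right; exists v; [left | apply: covered_In; left].
- by apply: covered_In; right.
Qed.

Lemma derivable_axiom R G w a :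
  List.In (w, a) G -> List.In (w, neg a) G -> derivable n (R, G).
Proof.
elim: a R G w => [p|p|a IHa b IHb|a IHa b IHb|a IHa|a IHa|i a IHa|i a IHa] R G w /= H1 H2.
- exists 0; apply: (derh_incl (R := R) (G := [:: (w, Var p); (w, NVar p)])) => //.
    by move=> A [<-|[<-|[]]].
  exact: (DId n 0 (IdI R [::] w p)).
- exists 0; apply: (derh_incl (R := R) (G := [:: (w, Var p); (w, NVar p)])) => //.
    by move=> A [<-|[<-|[]]].
  exact: (DId n 0 (IdI R [::] w p)).
- apply: (rc_or rc H2); apply: (rc_and rc (w := w) (a := a) (b := b)); first by right; right.
    by apply: (IHa _ _ w) => /=; auto.
  by apply: (IHb _ _ w) => /=; auto.
- apply: (rc_or rc H1); apply: (rc_and rc (w := w) (a := neg a) (b := neg b)).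
  + by right; right.
  + by apply: (IHa _ _ w) => /=; auto.
  + by apply: (IHb _ _ w) => /=; auto.
- apply: (rc_box rc H1) => v; apply: (rc_dia rc (w := w) (u := v) (a := neg a)); first by right.
  by apply: (IHa _ _ v) => /=; auto.
- apply: (rc_box rc H2) => v; apply: (rc_dia rc (w := w) (u := v) (a := a)); first by right.
  by apply: (IHa _ _ v) => /=; auto.
- apply: (derivable_stit H1) => v.
  apply: (rc_cstit rc (i := i) (w := w) (u := v) (a := neg a)); [by left| by right|].
  by apply: (IHa _ _ v) => /=; auto.
- apply: (derivable_stit H2) => v.
  apply: (rc_cstit rc (i := i) (w := w) (u := v) (a := a)); [by left| by right|].
  by apply: (IHa _ _ v) => /=; auto.
Qed.

(** * Cut *)

(** Inversion of a single formula, combined with weakening. *)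
Lemma derivable_replace R G w B T : (forall a, List.In a R -> List.In a T.1) ->
  (forall A, List.In A G -> List.In A T.2) -> covered T w B ->
  derivable n (R, (w, B) :: G) -> derivable n T.
Proof.
move=> H1 H2 c [h d]; exists h; apply: (derh_covered (s := id) d).
split=> /= [i y z|y A]; first exact: H1.
by case=> [[<- <-] //|H]; apply: covered_In; exact: H2.
Qed.

Definition cut_admissible A := forall R G x,
  derivable n (R, (x, A) :: G) -> derivable n (R, (x, neg A) :: G) -> derivable n (R, G).

(** Cut is symmetric in its premises, so a reduction is needed for only one formula of each dual
    pair. *)
Lemma cut_admissible_neg A : cut_admissible A -> cut_admissible (neg A).
Proof. by move=> H R G x d1 d2; apply: (H R G x) => //; rewrite negK in d2. Qed.

(* For these formulas the cut moves up the derivation of the premise that contains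
   the formula itself; at each principal occurrence it meets the inversion of the
   other premise. *)
Definition reduces_to_smaller_cuts A :=
  match A with
  | Var _ => True
  | And a b => cut_admissible a /\ cut_admissible b
  | Dia a | CStit _ a => cut_admissible a
  | _ => False
  end.

Lemma cut_reduction A : reduces_to_smaller_cuts A -> cut_admissible A.
Proof.
move=> HA R0 G0 x [h d1] d2.
(* The derivation from [neg A] carries no height: it is weakened as the sequent grows and used up at
   principal occurrences of [A]. *)
pose C T w B := List.In (w, B) T.2 \/
  [/\ w = x, B = A & derivable n (T.1, (x, neg A) :: T.2)].
have C_ext R R' G G' : (forall a, List.In a R -> List.In a R') ->
    (forall B, List.In B G -> List.In B G') -> extends C (R, G) (R', G').
  move=> H1 H2; split=> // w B [/H2|[-> ->]]; first by left.
  move=> d; right; split=> //; apply: derivable_incl d => // B' [->|/H2]; by [left|right].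
have C_cons R G w a : extends C (R, G) (R, (w, a) :: G) by apply: C_ext => // ? ?; right.
have up R G w a : (forall T', extends C (R, G) T' -> C T' w a -> derivable n T') ->
    derivable n (R, (w, a) :: G) by apply; [exact: C_cons | left; left].
apply: (interpretation (D := fun _ => derivable n) (C := C) (fun _ => rc) _ _ _ _ _ _ _ _
  (s := id) d1).
- by move=> R R' G w B H; case: (C_ext R R' G G H) => // _; apply.
(* If the cut formula is the variable of an initial sequent, its negation already occurs in the
   sequent, and the other premise only needs a contraction. *)
- move=> _ [R G] w p [H1|[-> E d]] [H2|[_ E' _]]; try by rewrite -E' in HA.
    exact: derivable_axiom H1 H2.
  by move: d; rewrite -E; apply: derivable_incl => //= B [<-|].
- move=> _ [R G] w a b c /up Ha /up Hb.
  case: c => [H|[Ew E d]]; first exact: rc_and rc _ _ _ _ _ H Ha Hb.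
  rewrite -E Ew in HA d Ha Hb; case: HA => cut_a cut_b.
  (* Inverting the disjunction [neg A] leaves two cuts, first on [a] beside [neg b], then on [b]. *)
  have d' : derivable n (R, (x, neg a) :: (x, neg b) :: G).
    apply: derivable_replace d => //= [B ?|]; first by right; right.
    by right; split; apply: covered_In => /=; auto.
  apply: (cut_b R G x) Hb _; apply: (cut_a R ((x, neg b) :: G) x) d'.
  by apply: derivable_incl Ha => //= B [<-|]; auto.
- move=> _ [R G] w a b [H|[_ E _]] Ha; last by rewrite -E in HA.
  apply: (rc_or rc H); apply: Ha; [|by left; left|by left; right; left].
  by apply: C_ext => // B; right; right.
- move=> _ [R G] w a [H|[_ E _]] Ha; last by rewrite -E in HA.
  by apply: (rc_box rc H) => v; apply: up => T'; exact: Ha.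
- move=> _ [R G] w u a c /up Ha.
  case: c => [H|[Ew E d]]; first exact: (rc_dia rc H Ha).
  rewrite -E in HA d; apply: (HA R G u) Ha _.
  (* Here [neg A] is a box, inverted at the very label [u] chosen by the diamond rule. *)
  apply: derivable_replace d => //= [B ?|]; first by right.
  by right; exists u; apply: covered_In; left.
- move=> _ [R G] w i a [H|[_ E _]] Ha; last by rewrite -E in HA.
  apply: (derivable_stit H) => v; apply: (Ha _ v) => /=; [|by left|by left; left].
  by apply: C_ext => ? ?; right.
- move=> _ [R G] w u i a c HR /up Ha.
  case: c => [H|[Ew E d]]; first exact: (rc_cstit rc HR H Ha).
  rewrite -E in HA d; rewrite Ew in HR; apply: (HA R G u) Ha _.
  apply: derivable_replace d => //= [B ?|]; first by right.
  by right; exists u => //; apply: covered_In; left.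
- split=> //= w B [[<- <-]|]; [by right | by left].
Qed.

Lemma cut A : cut_admissible A.
Proof.
elim: A => [p|p|a IHa b IHb|a IHa b IHb|a IHa|a IHa|i a IHa|i a IHa].
- exact: cut_reduction.
- exact: cut_admissible_neg (@cut_reduction (Var p) _).
- exact: cut_reduction.
- rewrite -(negK (Or a b)); apply/cut_admissible_neg/cut_reduction.
  by split; apply: cut_admissible_neg.
- rewrite -(negK (Box a)); apply/cut_admissible_neg/cut_reduction.
  exact: cut_admissible_neg.
- exact: cut_reduction.
- rewrite -(negK (Stit i a)); apply/cut_admissible_neg/cut_reduction.
  exact: cut_admissible_neg.
- exact: cut_reduction.
Qed.

(** * Completeness *)

(** The Euclidean rule applied to the given atom and a reflexive one yields the converse atom. *)
Lemma derivable_sym R G i x y : List.In (i, x, y) R ->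
  derivable n ((i, y, x) :: R, G) -> derivable n (R, G).
Proof.
move=> H d; apply: (rc_refl rc (i := i) (w := x)).
apply: (rc_eucl rc (i := i) (w := x) (u := y) (v := x)); [by right|by left|].
by apply: derivable_incl d => //= a; intuition.
Qed.

(** Once the first atom is reversed, both atoms start at [y] and the Euclidean rule applies. *)
Lemma derivable_trans R G i x y z : List.In (i, x, y) R -> List.In (i, y, z) R ->
  derivable n ((i, x, z) :: R, G) -> derivable n (R, G).
Proof.
move=> H1 H2 d; apply: (derivable_sym H1).
apply: (rc_eucl rc (i := i) (w := y) (u := x) (v := z)); [by left|by right|].
by apply: derivable_incl d => //= a; intuition.
Qed.

Lemma derivable_neg_bigAnd R G w l : List.In (w, neg (bigAnd l)) G ->
  derivable n (R, [seq (w, neg a) | a <- l] ++ G) -> derivable n (R, G).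
Proof.
elim: l G => [//|a [|b l] IH] G H d.
  by apply: derivable_incl d => //= A [<-|].
apply: (rc_or rc H); apply: IH; first by right; left.
by apply: derivable_incl d => //= A; rewrite !In_catP /=; intuition.
Qed.

Lemma derivable_bigAnd R G w l : List.In (w, bigAnd l) G ->
  (forall a, List.In a l -> derivable n (R, (w, a) :: G)) -> derivable n (R, G).
Proof.
elim: l G => [|a [|b l] IH] G H d.
- apply: (rc_or rc H); apply: (@derivable_axiom _ _ w (Var 0)) => /=; auto.
- by apply: derivable_incl (d a _) => [//|B /= [<-|]|]; [|by []|left].
apply: (rc_and rc H); first by apply: d; left.
apply: IH => [|c Hc]; first by left.
by apply: derivable_incl (d c _) => [//|A /=|]; [intuition|right].
Qed.

Lemma derivable_bigOr R G w l : List.In (w, bigOr l) G ->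
  derivable n (R, [seq (w, a) | a <- l] ++ G) -> derivable n (R, G).
Proof.
elim: l G => [//|a [|b l] IH] G H d.
  by apply: derivable_incl d => //= A [<-|].
apply: (rc_or rc H); apply: IH; first by right; left.
by apply: derivable_incl d => //= A; rewrite !In_catP /=; intuition.
Qed.

(** One box rule per index, with the eigenvariables collected in a function [u]. Since [l] has no
    repetition, the value of [u] at one index can be set without disturbing the others. *)
Lemma derivable_boxes (I : eqType) (l : seq I) (g : I -> form m) R G w : uniq l ->
  (forall i, i \in l -> List.In (w, Box (g i)) G) ->
  (forall u : I -> label, derivable n (R, [seq (u i, g i) | i <- l] ++ G)) ->
  derivable n (R, G).
Proof.
elim: l G => [|i l IH] G /=; first by move=> _ _; apply; exact: (fun=> 0).
move=> /andP [il ul] H d.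
apply: (rc_box rc (H i (mem_head _ _))) => v.
apply: (IH ((v, g i) :: G)) => // [j Hj|u].
  by right; apply: H; rewrite inE Hj orbT.
apply: derivable_incl (d (fun j => if j == i then v else u j)) => //= A.
rewrite eqxx !In_catP !In_mapP => -[<-|[[j ->]|]]; [by right;left| |by right;right].
rewrite In_memP => Hj; left; exists j; last by apply/In_memP.
by case: eqP => // E; rewrite -E Hj in il.
Qed.

(* The integer is the position of the principal formula in the sequent. *)
Tactic Notation "or_at" integer(k) := apply: (rc_or rc); [do k right; by left | rewrite ?negK].
Tactic Notation "and_at" integer(k) :=
  apply: (rc_and rc); [do k right; by left | rewrite ?negK | rewrite ?negK].
Tactic Notation "box_at" integer(k) ident(v) :=
  apply: (rc_box rc); [do k right; by left | move=> v; rewrite ?negK].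
Tactic Notation "stit_at" integer(k) ident(v) :=
  apply: derivable_stit; [do k right; by left | move=> v; rewrite ?negK].
Tactic Notation "dia_at" integer(k) constr(v) :=
  apply: (rc_dia rc (u := v)); [do k right; by left | rewrite ?negK].
Tactic Notation "cstit_at" integer(k) constr(v) :=
  apply: (rc_cstit rc (u := v)); [ | do k right; by left | rewrite ?negK];
  [rewrite /=; by auto 10 | idtac].
Ltac close x a := by apply: (@derivable_axiom _ _ x a); rewrite /= ?negK; auto 12.

(** The antecedent gives labels [u i], where agent [i] guarantees [f i], and the rule gives a common
    successor [v]. By transitivity, every [i]-successor [z] of [v] is one of [u i], so [f i] holds
    at [z]. *)
Lemma derivable_IOA (f : 'I_m -> form m) w :
  derivable n ([::], [:: (w, imp (bigAnd [seq Dia (Stit i (f i)) | i <- enum 'I_m])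
                             (Dia (bigAnd [seq Stit i (f i) | i <- enum 'I_m])))]).
Proof.
or_at 0; apply: derivable_neg_bigAnd; first by left.
apply: (derivable_boxes (w := w) (l := enum 'I_m) (g := fun i => neg (Stit i (f i)))).
- exact: enum_uniq.
- move=> i Hi; apply/(@In_catP (lform m)); left; rewrite -map_comp; apply/(@In_mapP _ (lform m)).
  by exists i => //; apply/In_memP.
move=> u; apply: (rc_ioa rc) => v; exists u.
set l := bigAnd [seq Stit i (f i) | i <- enum 'I_m].
apply: (rc_dia rc (w := w) (u := v) (a := l)); first by rewrite !In_catP /=; auto.
apply: derivable_bigAnd; first by left.
move=> _ /(@In_mapP _ (form m)) [i -> Hi]; stit_at 0 z.
apply: (derivable_trans (i := i) (x := u i) (y := v) (z := z)).
- right; apply/(@In_catP (ratom m)); left; apply/(@In_mapP _ (ratom m)); by exists i.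
- by left.
apply: (rc_cstit rc (i := i) (w := u i) (u := z) (a := neg (f i))); first by left.
  do 3 right; apply/(@In_catP (lform m)); left; apply/(@In_mapP _ (lform m)); by exists i.
close z (f i).
Qed.

(** The rule links two of the [n + 1] labels formed by [w] and the witnesses [u k]. A link from [w]
    to [u j] transports [f j] back to [w], giving a disjunct; a link from [u k] to [u j] transports
    [f k] to [u j], against the conjunct [neg (f k)] there. *)
Lemma derivable_APC (i : 'I_m) (f : nat -> form m) w : 0 < n ->
  derivable n ([::], [:: (w,
    imp (bigAnd [seq Dia (bigAnd (rcons [seq neg (f j) | j <- iota 1 k.-1] (Stit i (f k))))
                | k <- iota 1 n])
        (bigOr [seq f k | k <- iota 1 n]))]).
Proof.
move=> n0; or_at 0.
apply: derivable_neg_bigAnd; first by left.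
pose c k := rcons [seq neg (f j) | j <- iota 1 k.-1] (Stit i (f k)).
apply: (derivable_boxes (w := w) (l := iota 1 n) (g := fun k => neg (bigAnd (c k)))).
- exact: iota_uniq.
- move=> k Hk; apply/(@In_catP (lform m)); left; rewrite -map_comp; apply/(@In_mapP _ (lform m)).
  by exists k => //; apply/In_memP.
move=> u; apply: (derivable_bigOr (w := w) (l := [seq f k | k <- iota 1 n])).
  by rewrite !In_catP /=; auto.
(* The axiom counts its witnesses from 1, which leaves index 0 of the rule for [w]. *)
pose ws k := if k == 0 then w else u k.
apply: (rc_apc rc (i := i) (ws := ws) n0) => k j /andP [kj jn].
have j0 : 0 < j by exact: leq_ltn_trans kj.
have neg_c k0 R G (b : form m) : 0 < k0 <= n -> List.In b (c k0) ->
    derivable n (R, (u k0, neg b) :: [seq (w, a) | a <- [seq f k1 | k1 <- iota 1 n]] ++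
       [seq (u i0, neg (bigAnd (c i0))) | i0 <- iota 1 n] ++ G) ->
    derivable n (R, [seq (w, a) | a <- [seq f k1 | k1 <- iota 1 n]] ++
       [seq (u i0, neg (bigAnd (c i0))) | i0 <- iota 1 n] ++ G).
  move=> Hk Hb d; apply: (derivable_neg_bigAnd (w := u k0) (l := c k0)).
    apply/(@In_catP (lform m)); right; apply/(@In_catP (lform m)); left.
    by apply/(@In_mapP _ (lform m)); exists k0 => //; apply/In_memP; rewrite mem_iota add1n ltnS.
  apply: derivable_incl d => // B [<-|H]; apply/(@In_catP (lform m)); last by right.
  by left; apply/(@In_mapP _ (lform m)); exists b.
have last_c k0 : List.In (Stit i (f k0)) (c k0).
  by rewrite /c -cats1; apply/(@In_catP (form m)); right; left.
have [k0|k0] := posnP k; rewrite /ws (gtn_eqF j0).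
  rewrite k0 eqxx; apply: (derivable_sym (i := i) (x := w) (y := u j)); first by left.
  apply: (neg_c j) (last_c j) _; first by rewrite j0.
  cstit_at 0 w.
  apply: (@derivable_axiom _ _ w (f j)); last by left.
  do 2 right; apply/(@In_catP (lform m)); left; rewrite -map_comp; apply/(@In_mapP _ (lform m)).
  by exists j => //; apply/In_memP; rewrite mem_iota j0 add1n ltnS.
rewrite (gtn_eqF k0).
apply: (neg_c k) (last_c k) _; first by rewrite k0 (leq_trans (ltnW kj) jn).
cstit_at 0 (u j).
apply: (derivable_neg_bigAnd (w := u j) (l := c j)).
  do 2 right; apply/(@In_catP (lform m)); right; apply/(@In_catP (lform m)); left.
  by apply/(@In_mapP _ (lform m)); exists j => //; apply/In_memP; rewrite mem_iota add1n ltnS j0.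
apply: (@derivable_axiom _ _ (u j) (f k)); apply/(@In_catP (lform m)); last by right; left.
left; apply/(@In_mapP _ (lform m)); exists (neg (f k)); first by rewrite negK.
rewrite /c -cats1; apply/(@In_catP (form m)); left; apply/(@In_mapP _ (form m)).
by exists k => //; apply/In_memP; rewrite mem_iota k0 add1n prednK.
Qed.

Theorem thm_derivable (A : form m) w : thm n A -> derivable n ([::], [:: (w, A)]).
Proof.
move=> d; elim: d w => {A} /=.
- move=> a b w; rewrite /imp /= ?negK; or_at 0; or_at 1; close w a.
- move=> a b w; rewrite /imp /= ?negK; or_at 0; or_at 1; and_at 2; [close w b | close w a].
- move=> a b c w; rewrite /imp /= ?negK; or_at 0; or_at 1; or_at 1; and_at 4; first close w a.
  and_at 0; last close w c.
  and_at 4; [close w a | close w b].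
- move=> a b w; rewrite /imp /= ?negK; or_at 0; or_at 1; box_at 1 v; dia_at 3 v; dia_at 2 v.
  and_at 1; [close v a | close v b].
- move=> a w; rewrite /imp /= ?negK; or_at 0; dia_at 0 w; close w a.
- move=> a w; rewrite /imp /= ?negK; or_at 0; box_at 0 v; box_at 2 u; dia_at 0 v; close v a.
- move=> a w; rewrite /imp /= ?negK; or_at 0; close w (Box a).
- move=> i a b w; rewrite /imp /= ?negK; or_at 0; or_at 1; stit_at 1 v; cstit_at 3 v; cstit_at 2 v.
  and_at 1; [close v a | close v b].
- move=> i a w; rewrite /imp /= ?negK; or_at 0.
  apply: (rc_refl rc (i := i) (w := w)); cstit_at 0 w; close w a.
- move=> i a w; rewrite /imp /= ?negK; or_at 0; stit_at 0 v; stit_at 2 u.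
  apply: (rc_eucl rc (i := i) (w := w) (u := u) (v := v)); [by left|by right; left|].
  cstit_at 0 v; close v a.
- move=> i a w; rewrite /imp /= ?negK; or_at 0; close w (Stit i a).
- move=> i a w; rewrite /imp /= ?negK; or_at 0; stit_at 1 v; dia_at 1 v; close v a.
- exact: derivable_IOA.
- by move=> i f n0 w; exact: derivable_APC.
(* A cut on [a], with the implication inverted into [neg a] and [b]. *)
- move=> a b _ IHab _ IHa w; apply: (@cut a [::] _ w).
    by apply: derivable_incl (IHa w) => //= B [<-|[]]; left.
  apply: derivable_replace (IHab w) => //.
  by right; split; apply: covered_In; rewrite /=; auto.
- move=> a _ IHa w; box_at 0 v.
  by apply: derivable_incl (IHa v) => //= B [<-|[]]; left.
Qed.

(** * Soundness *)

(** Necessitation enters only through theorems, never below a hypothesis; this is what makes the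
    deduction theorem hold. *)
Inductive prov (X : form m -> Prop) : form m -> Prop :=
| ProvThm a : thm n a -> prov X a
| ProvHyp a : X a -> prov X a
| ProvMP a b : prov X (imp a b) -> prov X a -> prov X b.

Definition add (X : form m -> Prop) a b := X b \/ b = a.

Lemma prov_mono (X Y : form m -> Prop) a :
  (forall b, X b -> Y b) -> prov X a -> prov Y a.
Proof.
move=> XY; elim=> {a} [a|a /XY|a b _ IH1 _ IH2].
- exact: ProvThm.
- exact: ProvHyp.
- exact: ProvMP IH1 IH2.
Qed.

Lemma thm_imp_refl (a : form m) : thm n (imp a a).
Proof. exact: MP (MP (AxS n a (imp a a) a) (AxK1 _ _ _)) (AxK1 _ _ _). Qed.

Lemma prov_const X a b : prov X a -> prov X (imp b a).
Proof. by apply: ProvMP; apply: ProvThm; exact: AxK1. Qed.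

Lemma deduction X a b : prov (add X a) b -> prov X (imp a b).
Proof.
elim=> {b} [b d|b [d|->]|b c _ IH1 _ IH2].
- by apply: prov_const; exact: ProvThm.
- by apply: prov_const; exact: ProvHyp.
- by apply: ProvThm; exact: thm_imp_refl.
- by apply: ProvMP IH2; apply: ProvMP IH1; apply: ProvThm; exact: AxS.
Qed.

Lemma prov_efq X a b : prov X a -> prov X (neg a) -> prov X b.
Proof.
move=> Ha Hna; apply: ProvMP Ha.
by apply: (ProvMP (ProvThm _ (AxCP n a b))); exact: prov_const.
Qed.

Lemma prov_cases X a b : prov X (imp a b) -> prov X (imp (neg a) b) -> prov X b.
Proof.
move=> Hab Hnab.
have Hnba : prov X (imp (neg b) (neg a)).
  by apply: (ProvMP (ProvThm _ (AxCP n (neg b) (neg a)))); rewrite !negK.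
(* The theorem [t] serves a proof by contradiction: [neg b] yields [neg a], hence [b], hence
   [neg t], and contraposition turns this into a proof of [b] from [t]. *)
pose t := imp b b; have Ht : prov X t by apply: ProvThm; exact: thm_imp_refl.
apply: ProvMP Ht; apply: (ProvMP (ProvThm _ (AxCP n t b))).
have up c : prov X c -> prov (add X (neg b)) c by apply: prov_mono => ?; left.
have Hnb : prov (add X (neg b)) (neg b) by apply: ProvHyp; right.
apply: deduction; apply: (@prov_efq _ b) => //.
exact: ProvMP (up _ Hnab) (ProvMP (up _ Hnba) Hnb).
Qed.

(** * Maximal consistent sets *)

Local Arguments CodeSeq.code : simpl never.

(** The leading number separates the constructors; injectivity provides the enumeration of formulas
    used in Lindenbaum's construction. *)
Fixpoint code (A : form m) : nat :=
  CodeSeq.code match A with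
  | Var p => [:: 0; p]
  | NVar p => [:: 1; p]
  | And a b => [:: 2; code a; code b]
  | Or a b => [:: 3; code a; code b]
  | Box a => [:: 4; code a]
  | Dia a => [:: 5; code a]
  | Stit i a => [:: 6; val i; code a]
  | CStit i a => [:: 7; val i; code a]
  end.

Lemma code_inj : injective code.
Proof.
elim=> [p|p|a IHa b IHb|a IHa b IHb|a IHa|a IHa|i a IHa|i a IHa] [] //=.
- by move=> q /(can_inj CodeSeq.codeK) [->].
all: try by move=> *; match goal with H : _ = _ |- _ => move/(can_inj CodeSeq.codeK): H end.
- by move=> q /(can_inj CodeSeq.codeK) [->].
- by move=> c d /(can_inj CodeSeq.codeK) [/IHa -> /IHb ->].
- by move=> c d /(can_inj CodeSeq.codeK) [/IHa -> /IHb ->].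
- by move=> c /(can_inj CodeSeq.codeK) [/IHa ->].
- by move=> c /(can_inj CodeSeq.codeK) [/IHa ->].
- by move=> j c /(can_inj CodeSeq.codeK) [/val_inj -> /IHa ->].
- by move=> j c /(can_inj CodeSeq.codeK) [/val_inj -> /IHa ->].
Qed.

(** Consistency and maximality are combined in [mcs_neg]. *)
Record mcs (M : form m -> Prop) : Prop := Mcs {
  mcs_thm : forall a, thm n a -> M a;
  mcs_mp : forall a b, M (imp a b) -> M a -> M b;
  mcs_neg : forall a, M (neg a) <-> ~ M a }.

Fixpoint lindenbaum_stage (X : form m -> Prop) c k : form m -> Prop :=
  if k is k'.+1 then
    fun a => lindenbaum_stage X c k' a \/
             code a = k' /\ ~ prov (add (lindenbaum_stage X c k') a) c
  else X.

Lemma lindenbaum X c : ~ prov X c ->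
  exists M, [/\ mcs M, forall a, X a -> M a & ~ M c].
Proof.
move=> Xc; pose St := lindenbaum_stage X c.
have St_le k j a : k <= j -> St k a -> St j a.
  by move=> /subnKC <-; elim: (j - k) => [|d IH]; rewrite ?addn0 ?addnS // => /IH; left.
have St_c k : ~ prov (St k) c.
  elim: k => [//|k IH] d.
  (* At most one formula has code [k], so the next stage adds exactly that formula or nothing. *)
  case: (classic (exists2 a, code a = k & ~ prov (add (St k) a) c)) => [[a ak na]|no].
    apply: na; apply: prov_mono d => b [|[bk _]]; first by left.
    by right; apply: code_inj; rewrite bk.
  apply: IH; apply: prov_mono d => b [//|[bk nb]].
  by case: no; exists b.
pose M a := exists k, St k a.
have Mc : ~ prov M c.
  suff H a : prov M a -> exists k, prov (St k) a by case/H => k /St_c.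
  elim=> {a} [a d|a [k d]|a b _ [k d] _ [j e]].
  - by exists 0; exact: ProvThm.
  - by exists k; exact: ProvHyp.
  - exists (maxn k j); apply: ProvMP (prov_mono _ d) (prov_mono _ e) => x.
      by apply: St_le; exact: leq_maxl.
    by apply: St_le; exact: leq_maxr.
have Mmax a : ~ M a -> prov M (imp a c).
  move=> Ma; apply: deduction; apply: NNPP => d; apply: Ma; exists (code a).+1.
  right; split=> // e; apply: d; apply: prov_mono e => b [Hb|->]; [left|by right].
  by exists (code a).
have Mprov a : prov M a -> M a.
  by move=> d; apply: NNPP => /Mmax e; apply: Mc; exact: ProvMP e d.
exists M; split=> [|a Xa|/ProvHyp //]; last by exists 0.
split=> [a d|a b Mab Ma|a].
- by apply: Mprov; exact: ProvThm.
- by apply: Mprov; apply: ProvMP; apply: ProvHyp; eassumption.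
split=> [Mna Ma|Ma]; first by apply: Mc; apply: (@prov_efq _ a); exact: ProvHyp.
apply: NNPP => /Mmax e; apply: Mc; exact: prov_cases (Mmax _ Ma) e.
Qed.

Lemma mcs_or M a b : mcs M -> M (Or a b) <-> M a \/ M b.
Proof.
move=> HM; split=> [H|].
  case: (classic (M a)) => [|/(mcs_neg HM)]; [by left|right].
  by apply: (mcs_mp HM (a := neg a)) => //; rewrite /imp negK.
have E : imp (neg a) b = Or a b by rewrite /imp negK.
case=> [Ma|Mb]; last first.
  by rewrite -E; apply: (mcs_mp HM) Mb; apply: (mcs_thm HM); exact: AxK1.
rewrite -E; apply: (mcs_mp HM (mcs_thm HM (AxCP n (neg a) b))).
rewrite negK; apply: (mcs_mp HM) Ma; apply: (mcs_thm HM); exact: AxK1.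
Qed.

Lemma mcs_and M a b : mcs M -> M (And a b) <-> M a /\ M b.
Proof.
move=> HM; have H : M (And a b) <-> ~ M (Or (neg a) (neg b)).
  by rewrite -(mcs_neg HM) /= !negK.
by rewrite H (mcs_or _ _ HM) !(mcs_neg HM); case: (classic (M a)); case: (classic (M b)); tauto.
Qed.

Lemma mcs_bigAnd M l : mcs M -> M (bigAnd l) <-> forall a, List.In a l -> M a.
Proof.
move=> HM; elim: l => [|a [|b l] IH].
- split=> // _; apply/(mcs_or _ _ HM); rewrite (mcs_neg HM (Var 0)); exact: classic.
- by split=> [Ma b [<-|[]]|] //; apply; left.
rewrite -[bigAnd [:: a, b & l]]/(And a (bigAnd (b :: l))) (mcs_and _ _ HM) IH.
split=> [[Ma H] c [<-|/H]//|H]; split; [by apply: H; left|].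
by move=> c Hc; apply: H; right.
Qed.

Lemma mcs_bigOr M l : mcs M -> M (bigOr l) -> exists2 a, List.In a l & M a.
Proof.
move=> HM; elim: l => [|a [|b l] IH].
- by case/(mcs_and _ _ HM) => M0 /(mcs_neg HM (Var 0)).
- by exists a => //; left.
by case/(mcs_or _ _ HM) => [Ma|/IH [c Hc Mc]]; [exists a => //; left | exists c => //; right].
Qed.

(** * S5 modalities on maximal consistent sets *)

Record S5 (bx : form m -> form m) : Prop := MakeS5 {
  S5_K : forall a b, thm n (imp (bx (imp a b)) (imp (bx a) (bx b)));
  S5_nec : forall a, thm n a -> thm n (bx a);
  S5_T : forall a, thm n (imp (bx a) a);
  S5_5 : forall a, thm n (imp (neg (bx a)) (bx (neg (bx a)))) }.

Lemma S5_Box : S5 Box.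
Proof. by split=> *; [exact: BoxK | exact: Nec | exact: BoxT | exact: Box5]. Qed.

Lemma S5_Stit i : S5 (Stit i).
Proof.
split=> *; [exact: StitK | | exact: StitT | exact: Stit5].
by apply: MP (Bridge _ _ _) _; exact: Nec.
Qed.

(** The canonical accessibility relation. *)
Definition acc (bx : form m -> form m) (M N : form m -> Prop) := forall a, M (bx a) -> N a.

Section Modality.
Context (bx : form m -> form m) (bx5 : S5 bx).

Lemma acc_refl M : mcs M -> acc bx M M.
Proof. by move=> HM a; apply: (mcs_mp HM); apply: (mcs_thm HM); exact: S5_T. Qed.

Lemma acc_eucl M N P : mcs M -> mcs N -> mcs P -> acc bx M N -> acc bx M P -> acc bx N P.
Proof.
move=> HM HN HP MN MP a Na; apply: NNPP => Pa.
have /(mcs_neg HM) Ma : ~ M (bx a) by move=> /MP.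
have /MN /(mcs_neg HN) : M (bx (neg (bx a))) by apply: (mcs_mp HM (mcs_thm HM (S5_5 bx5 a))).
by [].
Qed.

Lemma acc_trans M N P : mcs M -> mcs N -> mcs P -> acc bx M N -> acc bx N P -> acc bx M P.
Proof.
move=> HM HN HP MN; apply: acc_eucl => //.
by apply: (@acc_eucl M) => //; exact: acc_refl.
Qed.

(** The formulas whose box lies in [M] do not prove [a], since necessitation and axiom K would put
    the box of [a] into [M]; Lindenbaum's construction extends them. *)
Lemma acc_witness M a : mcs M -> ~ M (bx a) -> exists N, [/\ mcs N, acc bx M N & ~ N a].
Proof.
move=> HM Ma; apply: lindenbaum => d; apply: Ma.
elim: d => {a} [a|//|a b _ IH1 _].
  by move=> /(S5_nec bx5); exact: mcs_thm.
by apply: (mcs_mp HM); apply: (mcs_mp HM) IH1; apply: (mcs_thm HM); exact: S5_K.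
Qed.

(** Each inaccessible [N j] omits some formula whose box lies in [M]; the conjunction of these
    finitely many formulas works for all [j]. *)
Lemma separation (I : eqType) (M : form m -> Prop) (N : I -> form m -> Prop) (l : seq I) :
  mcs M -> (forall j, mcs (N j)) -> (forall j, j \in l -> ~ acc bx M (N j)) ->
  exists2 A, M (bx A) & forall j, j \in l -> ~ N j A.
Proof.
move=> HM HN; elim: l => [|j l IH] H.
  exists (imp (Var 0) (Var 0)) => //.
  by apply: (mcs_thm HM); apply: (S5_nec bx5); exact: thm_imp_refl.
have [|A MA NA] := IH; first by move=> k Hk; apply: H; rewrite inE Hk orbT.
have [B MB NB] : exists2 B, M (bx B) & ~ N j B.
  apply: NNPP => no; apply: (H j (mem_head _ _)) => B MB.
  by apply: NNPP => NB; apply: no; exists B.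
exists (And B A) => [|k].
  apply: NNPP => /(acc_witness HM) [P [HP MP]]; apply; apply/(mcs_and _ _ HP).
  by split; apply: MP.
by rewrite inE => /orP [/eqP ->|/NA H'] /(mcs_and _ _ (HN _)) [].
Qed.

End Modality.

Lemma mcs_Dia M N a : mcs M -> mcs N -> acc Box M N -> N a -> M (Dia a).
Proof.
move=> HM HN MN Na; apply: NNPP => /(mcs_neg HM) /MN; by move/(mcs_neg HN).
Qed.

Lemma acc_Stit_Box i M N : mcs M -> acc (Stit i) M N -> acc Box M N.
Proof.
by move=> HM MN a Ma; apply: MN; apply: (mcs_mp HM) Ma; apply: (mcs_thm HM); exact: Bridge.
Qed.

(** * Independence of agents and bounded choice in the canonical model *)

(** The demands of all agents are jointly consistent: a refutation would use one formula per agent,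
    and the axiom (IOA) supplies a maximal consistent set where all these formulas are guaranteed at
    once. *)
Lemma ioa_witness M (N : 'I_m -> form m -> Prop) : mcs M -> (forall i, mcs (N i)) ->
  (forall i, acc Box M (N i)) -> exists2 P, mcs P & forall i, acc (Stit i) (N i) P.
Proof.
move=> HM HN MN.
pose X b := exists i, N i (Stit i b).
pose t : form m := imp (Var 0) (Var 0); have Ht : thm n t by exact: thm_imp_refl.
suff /lindenbaum [P [HP XP _]] : ~ prov X (neg t).
  by exists P => // i a Ha; apply: XP; exists i.
have Nt i : N i (Stit i t) by apply: (mcs_thm (HN i)); apply: S5_nec Ht; exact: S5_Stit.
(* A derivation from [X] is compressed into one formula [f i] for each agent. *)
suff H b : prov X b -> exists2 f : 'I_m -> form m, forall i, N i (Stit i (f i)) &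
    forall P, mcs P -> (forall i, P (Stit i (f i))) -> P b.
  case/H => f Nf Hf.
  have MD : M (Dia (bigAnd [seq Stit i (f i) | i <- enum 'I_m])).
    apply: (mcs_mp HM (mcs_thm HM (IOA n f))); apply/(mcs_bigAnd _ HM) => _ /In_mapP [i -> _].
    exact: mcs_Dia (MN i) (Nf i).
  have [|P [HP _]] := acc_witness S5_Box (a := neg (bigAnd [seq Stit i (f i) | i <- enum 'I_m])) HM.
    by apply/(mcs_neg HM); rewrite /= negK.
  rewrite (mcs_neg HP) => /NNPP /(mcs_bigAnd _ HP) Pf.
  have /(mcs_neg HP) : P (neg t).
    apply: Hf => // i; apply: Pf; apply/In_mapP; exists i => //.
    by apply/In_memP; rewrite mem_enum.
  by apply; exact: mcs_thm.
elim=> {b} [b Hb|b [i Hb]|b c _ [f Nf Hf] _ [g Ng Hg]].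
- by exists (fun=> t) => // P HP _; exact: mcs_thm.
(* The theorem [t] is the default for the agents that contribute nothing. *)
- exists (fun j => if j == i then b else t) => [j|P HP /(_ i)]; first by case: eqP => // ->.
  by rewrite eqxx; exact: (acc_refl (S5_Stit i)).
exists (fun i => And (f i) (g i)) => [i|P HP H].
  apply: NNPP => /(acc_witness (S5_Stit i) (HN i)) [P [HP NP]]; apply.
  by apply/(mcs_and _ _ HP); split; apply: NP.
have Hfg i : P (Stit i (f i)) /\ P (Stit i (g i)).
  have PT Q : mcs Q -> acc (Stit i) P Q -> Q (f i) /\ Q (g i).
    by move=> HQ PQ; apply/(mcs_and _ _ HQ); exact: PQ.
  by split; apply: NNPP => /(acc_witness (S5_Stit i) HP) [Q [HQ /(PT _ HQ) []]].
by apply: (mcs_mp HP) (Hg P HP _); [apply: Hf => // i; case: (Hfg i) | move=> i; case: (Hfg i)].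
Qed.

Lemma finite_choice (Y : Type) (Q : nat -> Y -> Prop) (y0 : Y) N :
  (forall k, k < N -> exists y, Q k y) -> exists f, forall k, k < N -> Q k (f k).
Proof.
elim: N => [|N IH] H; first by exists (fun=> y0).
have [|f Hf] := IH; first by move=> k Hk; apply: H; exact: ltnW.
have [y Hy] := H N (ltnSn N).
exists (update f N y) => k; rewrite ltnS /update leq_eqVlt.
by case: eqP => [-> //|_] /= /Hf.
Qed.

(** Without a link, separation gives for each [k < n] a formula that agent [i] guarantees at [N k]
    and that fails at every later set. These formulas satisfy the antecedent of the (APC) axiom at
    the last set [N n], where all its disjuncts fail. *)
Lemma apc_linked M (N : nat -> form m -> Prop) i : 0 < n -> mcs M -> (forall k, mcs (N k)) ->
  (forall k, acc Box M (N k)) -> exists k j, k < j <= n /\ acc (Stit i) (N k) (N j).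
Proof.
move=> n0 HM HN MN; apply: NNPP => no.
have [|f Hf] := @finite_choice _ (fun k A => N k (Stit i A) /\ forall j, k < j <= n -> ~ N j A)
    (Var 0) n.
  move=> k kn.
  have [|A NA HA] := @separation _ (S5_Stit i) _ (N k) N (iota k.+1 (n - k)) (HN k) HN.
    move=> j; rewrite mem_iota addSn ltnS subnKC ?(ltnW kn) // => kj H.
    by apply: no; exists k, j.
  exists A; split=> // j kj; apply: HA.
  by rewrite mem_iota addSn ltnS subnKC ?(ltnW kn).
(* The shift by one matches formulas counted from 1 with sets counted from 0. *)
have := mcs_thm (HN n) (APC i (fun k => f k.-1) n0).
move/(mcs_mp (HN n)) => H.
case: (mcs_bigOr (HN n) (H _)) => {H} [|_ /In_mapP [k -> /In_memP]]; last first.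
  rewrite mem_iota add1n ltnS => /andP [k0 kn].
  by case: (Hf k.-1 _) => [|_]; [rewrite prednK | apply; rewrite prednK // kn leqnn].
apply/(mcs_bigAnd _ (HN n)) => _ /In_mapP [k -> /In_memP].
rewrite mem_iota add1n ltnS => /andP [k0 kn].
have Hk : k.-1 < n by rewrite prednK.
apply: (mcs_Dia (HN n) (HN k.-1)).
  apply: (acc_eucl S5_Box HM) => //.
apply/(mcs_bigAnd _ (HN _)) => A; rewrite -cats1 => /In_catP [/In_mapP [j -> /In_memP]|[<-|[]]].
  rewrite mem_iota add1n prednK // => /andP [j0 jk]; apply/(mcs_neg (HN _)).
  have Hj : j.-1 < n by rewrite prednK // (leq_trans (ltnW jk)).
  case: (Hf _ Hj) => _; apply.
  by rewrite prednK // -ltnS prednK // jk ltnW.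
by case: (Hf _ Hk).
Qed.

(* Validity over the canonical model, which makes a truth lemma superfluous:
   labels denote maximal consistent sets in one [Box]-class, and a labelled
   formula holds when it is a member. *)
Definition valid S := forall M (V : label -> form m -> Prop),
  mcs M -> (forall x, mcs (V x)) -> (forall x, acc Box M (V x)) ->
  (forall i x y, List.In (i, x, y) S.1 -> acc (Stit i) (V x) (V y)) ->
  exists w A, List.In (w, A) S.2 /\ V w A.

(** For a rule with an eigenvariable, the valuation is updated there with a witness in the canonical
    model; freshness keeps the other values in the conclusion intact. *)
Lemma derh_valid h S : 0 < m -> derh n h S -> valid S.
Proof.
move=> m0; elim=> {h S} [h S S' [R G w p] [_ E]|h ps S S' HS [E1 E2] _ IH] M V HM HV MV HR.
  have H x B : V x B -> List.In (x, B) ((w, Var p) :: (w, NVar p) :: G) ->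
      exists w A, List.In (w, A) S'.2 /\ V w A.
    by move=> VB H; exists x, B; split=> //; exact: (Permutation_in _ E H).
  case: (classic (V w (Var p))) => Hp; first by apply: H Hp _; left.
  by move/(mcs_neg (HV w)): Hp => /H; apply; right; left.
suff [w [A [H VA]]] : exists w A, List.In (w, A) S.2 /\ V w A.
  by exists w, A; split=> //; exact: (Permutation_in _ E2 H).
have {}HR i x y : List.In (i, x, y) S.1 -> acc (Stit i) (V x) (V y).
  by move=> H; apply: HR; exact: (Permutation_in _ E1 H).
case: HS IH HR => {ps S E1 E2}.
- move=> R G w a b IH HR.
  have [x [B [HB VB]]] := IH _ (or_introl erefl) M V HM HV MV HR.
  have [y [C [HC VC]]] := IH _ (or_intror (or_introl erefl)) M V HM HV MV HR.
  case: HB => [?|[EB|?]]; [by exists x, B; split=> //; left| |by exists x, B; split=> //; right].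
  case: HC => [?|[EC|?]]; [by exists y, C; split=> //; left| |by exists y, C; split=> //; right].
  case: EB EC VB VC => <- <- [<- <-] Va Vb.
  by exists w, (And a b); split; [left | apply/(mcs_and _ _ (HV w))].
- move=> R G w a b IH HR.
  have [x [B [HB VB]]] := IH _ (or_introl erefl) M V HM HV MV HR.
  case: HB => [?|[EB|[EB|?]]]; [by exists x, B; split=> //; left| | |
    by exists x, B; split=> //; right]; case: EB VB => <- <- Va;
  by exists w, (Or a b); split; [left | apply/(mcs_or _ _ (HV w)); auto].
- move=> R G w v i a Hv IH HR.
  case: (classic (V w (Stit i a))) => [?|/(acc_witness (S5_Stit i) (HV w)) [N [HN wN Na]]].
    by exists w, (Stit i a); split=> //; left.
  have fw := update_fresh V N Hv (or_introl erefl).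
  have [|x|x|j x y|x [B [HB VB]]] := IH _ (or_introl erefl) M (update V v N).
  + by [].
  + by rewrite /update; case: ifP.
  + rewrite /update; case: ifP => // _.
    by apply: (acc_trans S5_Box HM (HV w) HN (MV w)); exact: acc_Stit_Box wN.
  + case=> [[<- <- <-]|H]; first by rewrite update_eq fw.
    by have [-> ->] := update_fresh_rel V N Hv H; exact: HR.
  case: HB => [EB|HB]; first by case: EB VB => <- <-; rewrite update_eq.
  by exists x, B; rewrite -(update_fresh V N Hv (or_intror HB)); split=> //; right.
- move=> R G w v a Hv IH HR.
  case: (classic (V w (Box a))) => [?|/(acc_witness S5_Box (HV w)) [N [HN wN Na]]].
    by exists w, (Box a); split=> //; left.
  have [|x|x|j x y H|x [B [HB VB]]] := IH _ (or_introl erefl) M (update V v N).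
  + by [].
  + by rewrite /update; case: ifP.
  + rewrite /update; case: ifP => // _.
    exact: (acc_trans S5_Box HM (HV w) HN (MV w)).
  + by have [-> ->] := update_fresh_rel V N Hv H; exact: HR.
  have HB' : List.In (x, B) ((w, Box a) :: G).
    case: HB => [->|[EB|H]]; [by left| |by right].
    by case: EB VB => <- <-; rewrite update_eq.
  by exists x, B; rewrite -(update_fresh V N Hv HB').
- move=> R G w u a IH HR.
  have [x [B [HB VB]]] := IH _ (or_introl erefl) M V HM HV MV HR.
  case: HB => [?|[EB|?]]; [by exists x, B; split=> //; left| |by exists x, B; split=> //; right].
  case: EB VB => <- <- Va; exists w, (Dia a); split; first by left.
  by apply: mcs_Dia Va => //; exact: (acc_eucl S5_Box HM).
- move=> R G u v Hv IH HR.
  have [N HN uN] := ioa_witness HM (fun i => HV (u i)) (fun i => MV (u i)).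
  have [|x|x|j x y|x [B [HB VB]]] := IH _ (or_introl erefl) M (update V v N).
  + by [].
  + by rewrite /update; case: ifP.
  (* The new set lies in the [Box]-class of [M] because it is accessible for some agent, and [0 < m]
     provides one. *)
  + rewrite /update; case: ifP => // _; pose i := Ordinal m0.
    by apply: (acc_trans S5_Box HM (HV (u i)) HN (MV (u i))); exact: acc_Stit_Box (uN i).
  + case/In_catP => [/In_mapP [i [-> -> ->] _]|H].
      (* Some [u i] may be the eigenvariable itself, in which case the atom is reflexive. *)
      rewrite update_eq /update; case: ifP => // _; exact: (acc_refl (S5_Stit i)).
    by have [-> ->] := update_fresh_rel V N Hv H; exact: HR.
  by exists x, B; rewrite -(update_fresh V N Hv HB).
- move=> R G w u i a IH HR.
  have [x [B [HB VB]]] := IH _ (or_introl erefl) M V HM HV MV HR.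
  case: HB => [?|[EB|?]]; [by exists x, B; split=> //; left| |by exists x, B; split=> //; right].
  case: EB VB => <- <- Va; exists w, (CStit i a); split; first by left.
  apply: NNPP => /(mcs_neg (HV w)) /(HR _ _ _ (or_introl erefl)).
  by move/(mcs_neg (HV u)).
- move=> R G w i IH HR; apply: (IH _ (or_introl erefl) M V HM HV MV) => j x y.
  by case=> [[<- <- <-]|/HR //]; exact: (acc_refl (S5_Stit i)).
- move=> R G w u v i IH HR; apply: (IH _ (or_introl erefl) M V HM HV MV) => j x y.
  case=> [?|[?|[[<- <- <-]|?]]]; try by apply: HR; rewrite /=; auto.
  by apply: (acc_eucl (S5_Stit i) (HV w)) => //; apply: HR; rewrite /=; auto.
- move=> R G i ws n0 IH HR.
  (* The linked pair selects the premise whose additional atom holds. *)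
  have [k [j [kj Hkj]]] := apc_linked i n0 HM (fun k => HV (ws k)) (fun k => MV (ws k)).
  apply: (IH ((i, ws k, ws j) :: R, G) _ M V HM HV MV) => [|l x y].
    by apply/In_apc_premises; exists k, j.
  by case=> [[<- <- <-]|/HR].
Qed.

Theorem derivable_thm (A : form m) w : 0 < m -> derivable n ([::], [:: (w, A)]) -> thm n A.
Proof.
move=> m0 [h d]; apply: NNPP => nA.
have /lindenbaum [M [HM _ MA]] : ~ prov (fun=> False) A.
  move=> dA; apply: nA; clear d; elim: dA => {}A // B _ AB _; exact: MP AB.
(* All labels denote the single set [M], which omits [A]. *)
have [//|x [B [[[_ <-] //|[]]]]] := derh_valid m0 d HM (fun=> HM) (fun=> acc_refl S5_Box HM).
Qed.

End Calculus.

Theorem theorem2 (m n : nat) : 0 < m ->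
  (* (1) generalized initial sequents *)
  (forall (R : seq (ratom m)) (G : seq (lform m)) (w : label) (phi : form m),
      derivable n (R, (w, phi) :: (w, neg phi) :: G)) /\
  (* (2) height-preserving admissibility of label substitution *)
  (forall (h : nat) (S : sequent m) (x y : label),
      derh n h S -> derh n h (subst_seq x y S)) /\
  (* (3) height-preserving invertibility of every rule *)
  (forall (prems : seq (sequent m)) (C : sequent m) (h : nat),
      rule_inst n prems C -> derh n h C ->
      forall P, List.In P prems -> derh n h P) /\
  (* (4) height-preserving weakening and contraction *)
  ((forall (h : nat) (R R' : seq (ratom m)) (G G' : seq (lform m)),
      derh n h (R, G) -> derh n h (R ++ R', G' ++ G)) /\
   (forall (h : nat) (R R' : seq (ratom m)) (G : seq (lform m)),
      derh n h (R ++ R' ++ R', G) -> derh n h (R ++ R', G)) /\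
   (forall (h : nat) (R : seq (ratom m)) (G G' : seq (lform m)),
      derh n h (R, G' ++ G' ++ G) -> derh n h (R, G' ++ G))) /\
  (* (5) admissibility of cut *)
  (forall (R : seq (ratom m)) (G : seq (lform m)) (x : label) (phi : form m),
      derivable n (R, (x, phi) :: G) -> derivable n (R, (x, neg phi) :: G) ->
      derivable n (R, G)) /\
  (* (6) soundness and completeness w.r.t. the Hilbert calculus *)
  (forall (phi : form m) (w : label),
      derivable n ([::], [:: (w, phi)]) <-> thm n phi).
Proof.
move=> m0; split; [|split; [|split; [|split; [split; [|split]|split]]]].
- by move=> R G w A; apply: (@derivable_axiom _ _ _ _ w A); [left | right; left].
- exact: derh_subst.
- by move=> ps S h r d; exact: derh_invert r d.
- move=> h R R' G G'; apply: derh_incl => A H; first by apply/(@In_catP (ratom m)); left.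
  by apply/(@In_catP (lform m)); right.
- by move=> h R R' G; apply: derh_incl => // A /In_catP [?|/In_catP [?|?]]; apply/In_catP; auto.
- by move=> h R G G'; apply: derh_incl => // A /In_catP [?|/In_catP [?|?]]; apply/In_catP; auto.
- by move=> R G x A; exact: cut.
- by move=> A w; split=> [/(derivable_thm m0)|/thm_derivable].
Qed.
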